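(* Let $G$ be a digraph whose underlying graph is a partial 3-tree. If $g(G) \geq 3$, then $\beta(G) \leq m(G)/3$. Moreover, if $g(G) = 3$, then $\nu(G) = g(G)$.
   Context: All graphs and digraphs are finite. A graph is a pair $(V,E)$ with $E$ a set of unordered pairs of distinct vertices. A digraph is a pair $(V,E)$ with $E$ a set of ordered pairs of distinct vertices, called arcs (so there are no loops or parallel arcs, but both $uv$ and $vu$ may be arcs). The underlying graph of a digraph has the same vertex set, and $u,v$ are adjacent in it if and only if at least one of $uv$, $vu$ is an arc. $m(G)$ is the number of arcs of $G$. A dicycle is a directed walk in which all vertices are distinct except that the first and last vertices coincide (directed cycle; length at least 2). A feedback arc set of $G$ is a set of arcs that intersects (the arc set of) every dicycle of $G$, and $\beta(G)$ is the size of a minimum feedback arc set of $G$. A packing is a set of pairwise disjoint feedback arc sets. $\nu(G)$ is the maximum size of a packing in $G$, and $g(G)$ is the length of a shortest dicycle in $G$, with $g(G)=\infty$ if $G$ has no dicycle. A clique is a set of pairwise adjacent vertices. A graph $H$ is a $k$-tree if it has $n \geq k+1$ vertices and there is an ordering $v_1,\ldots,v_n$ of its vertices such that for every $i$, the set $N_{H_i}(v_i)$ of neighbors of $v_i$ in $H_i$ is a clique of size $\min\{k,i-1\}$, where $H_i$ is the subgraph induced by $v_1,\ldots,v_i$. A partial $k$-tree is any graph that is a subgraph of a $k$-tree; here $k=3$. *)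

(* Defs.v *)
From mathcomp Require Import all_boot all_order all_algebra.

Set Implicit Arguments.
Unset Strict Implicit.
Unset Printing Implicit Defensive.

Record sgraph (V : finType) := SGraph {
  edge :> rel V;
  edge_sym : symmetric edge;
  edge_irr : irreflexive edge }.

Record digraph (V : finType) := Digraph {
  arc :> rel V;
  arc_irr : irreflexive arc }.

Definition clique (V : finType) (H : sgraph V) (A : {set V}) : Prop :=
  {in A &, forall x y, x != y -> H x y}.

(* The ordering is indexed from 0, so the i-th vertex has min(k, i) earlier
   neighbours; it is not its own neighbour because H is irreflexive. *)
Definition ktree (k : nat) (V : finType) (H : sgraph V) : Prop :=
  k.+1 <= #|V| /\
  exists2 v : 'I_#|V| -> V, bijective v &
    forall i : 'I_#|V|,
      let Hi := [set v j | j : 'I_#|V| & j <= i] in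
      let N := [set w in Hi | H (v i) w] in
      clique H N /\ #|N| = minn k i.

(* "Subgraph" is up to renaming vertices, and is not required to be induced or
   spanning: the k-tree may have more vertices. *)
Definition partial_ktree (k : nat) (V : finType) (H : sgraph V) : Prop :=
  exists (W : finType) (K : sgraph W) (f : V -> W),
    [/\ ktree k K, injective f & forall x y, H x y -> K (f x) (f y)].

Section Digraphs.

Variables (V : finType) (G : digraph V).

Definition adjacent : rel V := fun x y => G x y || G y x.

Fact adjacent_sym : symmetric adjacent.
Proof. by move=> x y; rewrite /adjacent orbC. Qed.

Fact adjacent_irr : irreflexive adjacent.
Proof. by move=> x; rewrite /adjacent !arc_irr. Qed.

Definition underlying : sgraph V := SGraph adjacent_sym adjacent_irr.

Definition arcs : {set V * V} := [set a | G a.1 a.2].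

Definition num_arcs : nat := #|arcs|.

(* A dicycle is given by its distinct vertices in cyclic order, the last one
   being followed by the first; its length is therefore [size c]. *)
Definition dicycle (c : seq V) : bool := [&& 1 < size c, uniq c & cycle G c].

Definition dicycle_arcs (c : seq V) : {set V * V} :=
  [set (x, next c x) | x in c].

(* Ranging over sequences of size at most #|V| loses no dicycle, since the
   vertices of a dicycle are distinct; see [fasP] and [digirthP]. *)
Definition fas (F : {set V * V}) : bool :=
  (F \subset arcs) &&
  [forall c : #|V|.-bseq V,
     dicycle c ==> (F :&: dicycle_arcs c != set0)].

Lemma dicycle_size c : dicycle c -> size c <= #|V|.
Proof. by case/and3P=> _ /card_uniqP <- _; apply: max_card. Qed.

Lemma fasP (F : {set V * V}) :
  reflect (F \subset arcs /\
           forall c, dicycle c -> F :&: dicycle_arcs c != set0) (fas F).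
Proof.
apply: (iffP andP) => -[sF hF]; split=> //.
  by move=> c dc; have /implyP := forallP hF (Bseq (dicycle_size dc)); apply.
by apply/forallP=> c; apply/implyP=> /hF.
Qed.

Lemma fas_arcs : fas arcs.
Proof.
apply/fasP; split=> // -[|x c] // /and3P[_ _ dc]; apply/set0Pn.
exists (x, next (x :: c) x); rewrite !inE /= (next_cycle dc) ?mem_head //=.
by apply/imsetP; exists x; rewrite ?mem_head.
Qed.

(* [arcs] is a feedback arc set by [fas_arcs], so this is a genuine minimum. *)
Definition beta : nat := #|[arg min_(F < arcs | fas F) #|F|]|.

Definition packing (P : {set {set V * V}}) : bool :=
  [forall F in P, fas F] && trivIset P.

Definition nu : nat := \max_(P | packing P) #|P|.

(* [None] stands for infinity. *)
Definition digirth : option nat :=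
  if [pick c : #|V|.-bseq V | dicycle c] is Some c0
  then Some (size [arg min_(c < c0 | dicycle c) size c])
  else None.

Lemma digirthP :
  match digirth with
  | Some n => (exists2 c, dicycle c & size c = n) /\
              forall c, dicycle c -> n <= size c
  | None => forall c, ~~ dicycle c
  end.
Proof.
rewrite /digirth; case: pickP => [c0 d0|d0].
  case: arg_minnP => // c dc cmin; split=> [|c' dc']; first by exists c.
  exact: (cmin (Bseq (dicycle_size dc'))).
move=> c; apply/negP=> dc.
by have := d0 (Bseq (dicycle_size dc)); rewrite /= dc.
Qed.

End Digraphs.

Definition leq_inf (k : nat) (x : option nat) : bool :=
  if x is Some n then k <= n else true.

(* Main.v *)
(* If three rankings of the vertices make every arc backward in exactly one of
   them, then the three sets of backward arcs are pairwise disjoint feedback arc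
   sets, since a dicycle descends somewhere in each ranking.  Such rankings of an
   oriented 3-tree are built along its elimination ordering: when v is added, its
   at most three earlier neighbours x, y, z are pairwise adjacent, so no ranking
   order among two of them is unanimous, and this leaves room to choose for each
   neighbour the ranking in which its arc with v is backward.  If v dominates all
   of x, y, z (or none), the same ranking serves for all; otherwise z, say, differs
   from x and y, and the choice only depends on which rankings put x and y
   before z (split_colors). *)

Require Import Defs.
From mathcomp Require Import all_boot all_order all_algebra.

Set Implicit Arguments.
Unset Strict Implicit.
Unset Printing Implicit Defensive.

Import Order.TTheory GRing.Theory Num.Theory.

Local Open Scope ring_scope.

(** * Choosing among three colours *)

Lemma third_color (i j : 'I_3) :
  i != j -> exists2 k, (k != i) && (k != j) & forall l, [|| l == i, l == j | l == k].
Proof.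
by case: i j => [[|[|[|//]]] ?] [[|[|[|//]]] ?] // _;
  (exists ord0 + exists 1 + exists ord_max) => // -[[|[|[|//]]] ?].
Qed.

(** Think of [A] and [B] as the rankings in which x, respectively y, precedes z; then [a], [b], [c]
    will be the colours of x, y, z. If some k avoids both [A] and [B], one of the other two colours
    serves as [a = b] and the last as [c]. Otherwise [i] lies only in [B] and [j] only in [A], so
    [a = j], [b = i] and [c] is the third colour. *)
Lemma split_colors (A B : pred 'I_3) (i j : 'I_3) : ~~ A i -> ~~ B j ->
  exists a b c : 'I_3,
    [/\ (c != a) && (c != b),
        forall k, A k -> k != c -> k = a,
        forall k, B k -> k != c -> k = b
      & a = b \/ [/\ A a, ~~ B a, B b & ~~ A b]].
Proof.
move=> Ai Bj; case: (pickP [pred k | ~~ A k && ~~ B k]) => [k /andP[Ak Bk]|AB].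
  have [|c /andP[ck ck1] all3] := @third_color k (k + 1).
    by rewrite -subr_eq0 opprD addNKr oppr_eq0.
  exists (k + 1), (k + 1), c; rewrite ck1; split=> //; last by left.
    by move=> l Al /negPf lc; have := all3 l; rewrite lc orbF => /orP[]/eqP // lk;
       rewrite lk (negPf Ak) in Al.
  by move=> l Bl /negPf lc; have := all3 l; rewrite lc orbF => /orP[]/eqP // lk;
     rewrite lk (negPf Bk) in Bl.
have {}AB k : A k || B k by have /negbT := AB k; rewrite /= -negb_or negbK.
have Bi : B i by have := AB i; rewrite (negPf Ai).
have Aj : A j by have := AB j; rewrite (negPf Bj) orbF.
have [|c /andP[ci cj] all3] := @third_color i j.
  by apply: contraNneq Ai => ->.
exists j, i, c; rewrite ci cj; split=> //; last by right.
  move=> k Ak /negPf kc; have := all3 k; rewrite kc orbF => /orP[]/eqP // ki.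
  by rewrite -ki Ak in Ai.
move=> k Bk /negPf kc; have := all3 k; rewrite kc orbF => /orP[]/eqP // kj.
by rewrite -kj Bk in Bj.
Qed.

(** * Inserting one vertex into three rankings *)

Section Insertion.

Variable W : finType.
Implicit Types (N : {set W}) (x y z : W).

(** Rational ranks leave room: take the midpoint between the highest vertex outside [f] and the
    lowest one in [f], or go one unit beyond the extreme if one side is empty. *)
Lemma exists_gap N (f : pred W) (r : W -> rat) :
  {in N &, forall x y, ~~ f x -> f y -> r x < r y} ->
  exists q, {in N, forall x, if f x then q < r x else r x < q}.
Proof.
move=> h.
case: (pickP [pred x in N | ~~ f x]) => [x0 Lx0|L0];
case: (pickP [pred x in N | f x]) => [y0 Uy0|U0].
- case: (Order.TotalTheory.arg_maxP r Lx0) => x /andP[xN fx] xmax.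
  case: (Order.TotalTheory.arg_minP r Uy0) => y /andP[yN fy] ymin.
  have xy := h _ _ xN yN fx fy.
  exists ((r x + r y) / 2) => u uN; case: ifP => fu.
    by apply: lt_le_trans (midf_lt xy).2 (ymin _ _); rewrite /= uN fu.
  by apply: le_lt_trans (xmax _ _) (midf_lt xy).1; rewrite /= uN fu.
- case: (Order.TotalTheory.arg_maxP r Lx0) => x /andP[xN fx] xmax.
  exists (r x + 1) => u uN; have := U0 u; rewrite /= uN /= => fu; rewrite fu.
  by apply: ltr_pwDr; rewrite // [_ <= _]xmax //= uN fu.
- case: (Order.TotalTheory.arg_minP r Uy0) => y /andP[yN fy] ymin.
  exists (r y - 1) => u uN; have := L0 u; rewrite /= uN /= => /negbFE fu.
  by rewrite fu ltrBlDr; apply: ltr_pwDr; rewrite // [_ <= _]ymin //= uN fu.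
by exists 0 => u uN; have := L0 u; have := U0 u; rewrite /= uN /= => ->.
Qed.

(* A new vertex preceding x in all rankings but [col x] if [t x], and only in
   ranking [col x] otherwise, can be inserted in every ranking. *)
Definition insertable N (r : 'I_3 -> W -> rat) (t : pred W) (col : W -> 'I_3) :=
  forall i, {in N &, forall x y, ~~ (t x (+) (i == col x)) ->
    t y (+) (i == col y) -> r i x < r i y}.

(** Reversing the rankings and the arcs at the new vertex exchanges before and after; this reduces
    one out-neighbour against two in-neighbours to the opposite case. *)
Lemma insertable_opp N r t col :
  insertable N (fun i x => - r i x) (predC t) col -> insertable N r t col.
Proof.
move=> h i x y xN yN fx fy; have := h i y x yN xN.
by rewrite ltrN2 /= !addNb negbK; apply.
Qed.

(** With a single colour the new vertex goes before all of [N] or after all of [N] in each ranking,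
    so there is no pair to compare. *)
Lemma insertable_const N r t b :
  {in N, forall x, t x = b} -> insertable N r t (fun=> ord0).
Proof. by move=> h i x y xN yN; rewrite !h // => /negPf->. Qed.

(** Read for both (x, y) and (y, x), the second clause says that neither order is unanimous. The
    first clause excludes ties. *)
Definition separated N (r : 'I_3 -> W -> rat) :=
  {in N &, forall x y, x != y ->
    (forall i, r i x != r i y) /\ exists i, r i x < r i y}.

Lemma separated_opp N r : separated N r -> separated N (fun i x => - r i x).
Proof.
move=> h x y xN yN xy; split=> [i|].
  by rewrite eqr_opp; apply: (h x y xN yN xy).1.
have [|_ [i]] := h y x yN xN; first by rewrite eq_sym.
by exists i; rewrite ltrN2.
Qed.

(** In ranking [c] all three neighbours come after the new vertex. In any other ranking z comes
    before it, while x does so only in ranking [a] and y only in ranking [b]; where x or y comes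
    after it, [hA] or [hB] puts z below that neighbour. If [a] and [b] differ, x < z < y in ranking
    [a] and y < z < x in ranking [b]. *)
Lemma insertable2_1 N r (t : pred W) x y z : separated N r ->
  N = [set x; y; z] -> t x -> t y -> ~~ t z -> exists col, insertable N r t col.
Proof.
move=> sep Nxyz tx ty tz.
have [xN yN zN] : [/\ x \in N, y \in N & z \in N].
  by rewrite Nxyz !inE !eqxx !orbT.
have xz : x != z by apply: contraNneq tz => <-.
have yz : y != z by apply: contraNneq tz => <-.
have {}sep u : u \in N -> u != z ->
    (forall i, ~~ (r i u < r i z) = (r i z < r i u)) /\ exists i, ~~ (r i u < r i z).
  move=> uN uz; have [ne _] := sep u z uN zN uz.
  have [|_ [i lti]] := sep z u zN uN; first by rewrite eq_sym.
  split; last by exists i; rewrite -leNgt ltW.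
  by move=> j; rewrite -leNgt le_eqVlt eq_sym (negPf (ne j)).
have [xlt [i Ai]] := sep x xN xz; have [ylt [j Bj]] := sep y yN yz.
have [a [b [c [/andP[ca cb] hA hB hab]]]] :=
  @split_colors [pred i | r i x < r i z] [pred i | r i y < r i z] i j Ai Bj.
pose col u := if u == z then c else if u == x then a else b.
have colx : col x = a by rewrite /col (negPf xz) eqxx.
have colz : col z = c by rewrite /col eqxx.
have coly : col y = b.
  (* The vertices x and y may coincide; then the two predicates agree, which forces [a = b]. *)
  rewrite /col (negPf yz); case: eqP => // yx; case: hab => // -[/= h1 h2].
  by rewrite yx h1 in h2.
exists col => k u w; rewrite Nxyz !inE -!orbA.
case/or3P=> /eqP-> /or3P[] /eqP->; rewrite ?colx ?coly ?colz ?tx ?ty ?(negPf tz) /=;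
  rewrite ?negbK //.
- by move=> ->.
- move=> /eqP-> nab; case: hab => [ab|[/= h1 h2 _ _]]; first by rewrite ab eqxx in nab.
  by apply: lt_trans h1 _; rewrite -ylt.
- by move=> /eqP-> ac; rewrite eq_sym ac in ca.
- move=> /eqP-> nba; case: hab => [ab|[/= _ _ h1 h2]]; first by rewrite ab eqxx in nba.
  by apply: lt_trans h1 _; rewrite -xlt.
- by move=> ->.
- by move=> /eqP-> bc; rewrite eq_sym bc in cb.
- by move=> kc; rewrite -xlt; apply: contraNN => /hA/(_ kc)->.
- by move=> kc; rewrite -ylt; apply: contraNN => /hB/(_ kc)->.
- by move=> /negPf->.
Qed.

Lemma insertable3 N r (t : pred W) : separated N r -> (#|N| <= 3)%N ->
  exists col, insertable N r t col.
Proof.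
move=> sep N3; have [->|[x xN]] := set_0Vmem N.
  by exists (fun=> ord0) => i x y; rewrite inE.
(* A smaller neighbourhood is padded by repeating vertices. *)
have [y [z Nxyz]] : exists y z, N = [set x; y; z].
  have := N3; rewrite (cardsD1 x) xN ltnS => N2.
  have [N0|[y yN]] := set_0Vmem (N :\ x).
    by exists x, x; rewrite -(setD1K xN) N0 !setUid setU0.
  have := N2; rewrite (cardsD1 y) yN ltnS => N1.
  have [N0|[z zN]] := set_0Vmem (N :\ x :\ y).
    by exists y, y; rewrite -(setD1K xN) -(setD1K yN) N0 setU0 -setUA setUid.
  exists y, z; rewrite -(setD1K xN) -(setD1K yN) -(setD1K zN).
  have := N1; rewrite (cardsD1 z) zN ltnS leqn0 cards_eq0 => /eqP->.
  by rewrite setU0 setUA.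
have Nxzy : N = [set x; z; y] by rewrite Nxyz setUAC.
have Nyzx : N = [set y; z; x] by rewrite Nxyz -setUA setUC.
have sepN := separated_opp sep.
have flip : (exists col, insertable N (fun i x => - r i x) (predC t) col) ->
    exists col, insertable N r t col.
  by case=> col /insertable_opp; exists col.
have const b : t x = b -> t y = b -> t z = b -> exists col, insertable N r t col.
  move=> tx ty tz; exists (fun=> ord0); apply: (@insertable_const _ _ _ b) => u.
  by rewrite Nxyz !inE -orbA => /or3P[] /eqP->.
case tx: (t x); case ty: (t y); case tz: (t z).
- exact: (const true).
- by apply: (insertable2_1 sep Nxyz); rewrite ?tx ?ty ?tz.
- by apply: (insertable2_1 sep Nxzy); rewrite ?tx ?ty ?tz.
- by apply: flip; apply: (insertable2_1 sepN Nyzx); rewrite /= ?tx ?ty ?tz.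
- by apply: (insertable2_1 sep Nyzx); rewrite ?tx ?ty ?tz.
- by apply: flip; apply: (insertable2_1 sepN Nxzy); rewrite /= ?tx ?ty ?tz.
- by apply: flip; apply: (insertable2_1 sepN Nxyz); rewrite /= ?tx ?ty ?tz.
- exact: (const false).
Qed.

End Insertion.

(** * Rankings along the elimination ordering of a 3-tree *)

Definition backward_once (W : finType) (r : 'I_3 -> W -> rat) (x y : W) :=
  exists c, forall i, if i == c then r i y < r i x else r i x < r i y.

Lemma backward_once_separates (W : finType) (r : 'I_3 -> W -> rat) x y :
  backward_once r x y ->
  (forall i, r i x != r i y) /\
  (exists i, r i x < r i y) /\ exists i, r i y < r i x.
Proof.
move=> [c h]; split; [|split].
- by move=> i; have := h i; case: ifP => _ /lt_eqF; [rewrite eq_sym|] => ->.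
(* Addition in ['I_3] is modulo 3, so [c + 1] is a ranking other than [c]. *)
- by exists (c + 1); have := h (c + 1); rewrite -subr_eq0 addrAC subrr add0r.
- by exists c; have := h c; rewrite eqxx.
Qed.

Section KTree.

Variables (W : finType) (K : sgraph W) (T : rel W).
Hypothesis tourT : forall x y, x != y -> T y x = ~~ T x y.

Definition realizes (A : {set W}) (r : 'I_3 -> W -> rat) :=
  {in A &, forall x y, K x y -> T x y -> backward_once r x y}.

Lemma realizes_separated (A N : {set W}) r :
  realizes A r -> N \subset A -> clique K N -> separated N r.
Proof.
move=> h /subsetP NA cN x y xN yN xy; have Kxy := cN x y xN yN xy.
have [xA yA] := (NA x xN, NA y yN).
case Txy: (T x y).
  by have [ne [lt _]] := backward_once_separates (h x y xA yA Kxy Txy).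
have Tyx : T y x by rewrite tourT ?Txy.
rewrite edge_sym in Kxy.
have [ne [_ lt]] := backward_once_separates (h y x yA xA Kxy Tyx).
by split=> // i; rewrite eq_sym.
Qed.

Lemma realizes_extend (A : {set W}) v r : v \notin A ->
  clique K [set w in A | K v w] -> (#|[set w in A | K v w]| <= 3)%N ->
  realizes A r -> exists r', realizes (v |: A) r'.
Proof.
set N := [set w in A | K v w] => vA cN N3 hr.
have NA : N \subset A by apply/subsetP => x; rewrite inE => /andP[].
have [col hcol] := insertable3 (T v) (realizes_separated hr NA cN) N3.
(* One gap per ranking: [q i] is the rank of [v] in ranking [i]. *)
have [q hq] := fin_all_exists (fun i => exists_gap (hcol i)).
pose r' i x := if x == v then q i else r i x.
have r'v i : r' i v = q i by rewrite /r' eqxx.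
have r'A i x : x \in A -> r' i x = r i x.
  by move=> xA; rewrite /r'; case: eqP => // xv; rewrite -xv xA in vA.
exists r' => x y; rewrite !inE => /predU1P[->|xA] /predU1P[->|yA].
- by rewrite edge_irr.
- move=> Kvy Tvy; exists (col y) => i; rewrite r'v r'A //.
  have yN : y \in N by rewrite inE yA.
  by have := hq i y yN; rewrite Tvy; case: (i == col y).
- rewrite edge_sym => Kvx Txv; exists (col x) => i; rewrite r'v r'A //.
  have xN : x \in N by rewrite inE xA.
  have nTvx : T v x = false.
    by rewrite tourT ?Txv //; apply: contraNneq vA => <-.
  by have := hq i x xN; rewrite nTvx; case: (i == col x).
- move=> Kxy Txy; have [c hc] := hr x y xA yA Kxy Txy.
  by exists c => i; rewrite !r'A.
Qed.

Lemma ktree_realizes : ktree 3 K -> exists r, realizes setT r.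
Proof.
case=> _ [v bij_v hv].
suff /(_ #|W| (leqnn _)) [r hr] : forall m, (m <= #|W|)%N ->
    exists r, realizes [set v j | j : 'I_#|W| & (j < m)%N] r.
  have [u _ vu] := bij_v.
  by exists r => x y _ _; apply: hr; rewrite -[X in X \in _]vu;
     apply: imset_f; rewrite inE ltn_ord.
elim=> [_|m IHm mW].
  by exists (fun _ _ => 0) => x y /imsetP[j]; rewrite inE.
have [r hr] := IHm (ltnW mW).
pose i := Ordinal mW; set A := [set _ | _ in _] in hr.
have inj_v := bij_inj bij_v.
have AS : [set v j | j : 'I_#|W| & (j < m.+1)%N] = v i |: A.
  apply/setP=> x; rewrite !inE; apply/imsetP/predU1P => [[j]|[->|]].
  - rewrite inE ltnS leq_eqVlt => /predU1P[jm|jm] ->.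
      by left; congr v; apply: val_inj.
    by right; apply: imset_f; rewrite inE.
  - by exists i; rewrite ?inE /=.
  - by case/imsetP=> j; rewrite inE => jm ->; exists j; rewrite // inE ltnW.
have [] := hv i; rewrite /=.
(* The prefix in [ktree] contains [v i] itself, unlike [A]; irreflexivity of [K] makes the two
   neighbourhoods equal. *)
have -> : [set w in [set v j | j : 'I_#|W| & (j <= m)%N] | K (v i) w]
          = [set w in A | K (v i) w].
  rewrite (AS : [set v j | j : 'I_#|W| & (j <= m)%N] = _).
  by apply/setP=> w; rewrite !inE; case: eqP => // ->; rewrite edge_irr !andbF.
move=> cN cardN; rewrite AS; apply: realizes_extend hr => //.
  by apply/imsetP=> -[j]; rewrite inE => jm /inj_v ij; rewrite -ij ltnn in jm.
by rewrite cardN geq_minl.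
Qed.

End KTree.

(** * From rankings to feedback arc sets and packings *)

Section Digraph.

Variables (V : finType) (G : digraph V).

(** The arc leaving a vertex of [c] of maximal rank descends. Ties are excluded only along arcs, so
    [r] need not be injective. *)
Lemma dicycle_descent (r : V -> rat) c :
  (forall x y, G x y -> r x != r y) -> dicycle G c ->
  exists2 x, x \in c & r (next c x) < r x.
Proof.
move=> inj_r /and3P[c1 _ cyc].
have [x0 x0c] : exists x0, x0 \in c by case: c c1 {cyc} => // x c; exists x; rewrite mem_head.
case: (Order.TotalTheory.arg_maxP r x0c) => x xc xmax; exists x => //.
have nxc : next c x \in c by rewrite mem_next.
have {}xmax : r (next c x) <= r x by apply: xmax.
by rewrite lt_neqAle xmax andbT eq_sym; apply: inj_r; apply: next_cycle.
Qed.

Lemma partial_3tree_realizes : partial_ktree 3 (underlying G) ->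
  (forall x y, G x y -> ~~ G y x) ->
  exists r, forall x y, G x y -> backward_once r x y.
Proof.
move=> [W [K [f [ktK inj_f fK]]]] asymG.
pose im x y := [exists u, exists v, [&& f u == x, f v == y & G u v]].
have imP x y : reflect (exists u v, [/\ f u = x, f v = y & G u v]) (im x y).
  apply: (iffP existsP) => [[u /existsP[v /and3P[/eqP fu /eqP fv Guv]]]|].
    by exists u, v.
  by case=> u [v [<- <- Guv]]; exists u; apply/existsP; exists v; rewrite !eqxx.
have im_asym x y : im x y -> im y x = false.
  case/imP=> u [v [fu fv Guv]]; apply/imP => -[v' [u' [fv' fu' Gvu]]].
  have /negP[] := asymG _ _ Guv.
  by rewrite -(inj_f v' v) ?fv' // -(inj_f u' u) ?fu'.
(* Pairs that carry no arc of [G] are oriented by enumeration rank: the insertion step needs every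
   edge of the 3-tree oriented in order to separate adjacent vertices. *)
pose T x y := im x y || ~~ im y x && (enum_rank x < enum_rank y)%N.
have tourT x y : x != y -> T y x = ~~ T x y.
  move=> xy; rewrite /T; case imxy: (im x y); first by rewrite im_asym.
  case: (im y x) => //=; rewrite -leqNgt ltn_neqAle.
  by rewrite (inj_eq (@ord_inj _)) (inj_eq enum_rank_inj) eq_sym xy.
have [r hr] := ktree_realizes tourT ktK.
exists (fun i x => r i (f x)) => x y Gxy.
apply: (hr (f x) (f y)); rewrite ?inE //.
  by apply: fK; rewrite /= /adjacent Gxy.
by apply/orP; left; apply/imP; exists x, y.
Qed.

Lemma beta_le F : fas G F -> (beta G <= #|F|)%N.
Proof. by rewrite /beta; case: arg_minnP => [|F0 _ min /min //]; apply: fas_arcs. Qed.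

Lemma beta_packing P : packing G P -> (#|P| * beta G <= num_arcs G)%N.
Proof.
move=> /andP[/forall_inP fasA trivP].
apply: (@leq_trans #|cover P|).
  by rewrite -(eqP trivP) -sum_nat_const; apply: leq_sum => F /fasA/beta_le.
by apply/subset_leq_card/bigcupsP => F /fasA/fasP[].
Qed.

(** Picking in each set of a packing one arc of [c] is injective, because the sets are disjoint. *)
Lemma nu_le_dicycle c : dicycle G c -> (nu G <= size c)%N.
Proof.
move=> dc; apply/bigmax_leqP => P /andP[/forall_inP fasA /trivIsetP trivP].
pose D := dicycle_arcs c; pose h (F : {set V * V}) := [pick a in F :&: D].
have hP F : F \in P -> exists2 a, h F = Some a & a \in F :&: D.
  move=> /fasA/fasP[_ /(_ c dc)/set0Pn[b bFD]]; rewrite /h.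
  by case: pickP => [a aFD|/(_ b)]; [exists a | rewrite bFD].
have inj_h : {in P &, injective h}.
  move=> F F' FP F'P; have [a -> /setIP[aF _]] := hP F FP.
  have [b -> /setIP[bF' _]] := hP F' F'P; case=> ab.
  apply: contraTeq aF => /(trivP _ _ FP F'P); rewrite disjoint_sym => dis.
  by rewrite ab (disjointFr dis bF').
rewrite -(card_in_imset inj_h); apply: (@leq_trans #|Some @: D|).
  apply/subset_leq_card/subsetP => _ /imsetP[F FP ->].
  by have [a -> /setIP[_ aD]] := hP F FP; apply: imset_f.
by rewrite card_imset; [apply: leq_trans (leq_imset_card _ _) (card_size _) | move=> ? ? []].
Qed.

Lemma backward_packing r c :
  (forall x y, G x y -> backward_once r x y) -> dicycle G c ->
  exists2 P, packing G P & #|P| = 3.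
Proof.
move=> hr dc; pose F i := [set a in arcs G | r i a.2 < r i a.1].
have fasF i : fas G (F i).
  apply/fasP; split=> [|c' dc']; first by apply/subsetP => a; rewrite inE => /andP[].
  have [|x xc xlt] := @dicycle_descent (r i) c' _ dc'.
    by move=> x y /hr /backward_once_separates[].
  apply/set0Pn; exists (x, next c' x); rewrite !inE /= xlt andbT.
  by rewrite imset_f // andbT; have /and3P[_ _ cyc] := dc'; apply: next_cycle.
have uniqF i j a : a \in F i -> a \in F j -> i = j.
  rewrite !inE => /andP[Ga lti] /andP[_ ltj]; have [k hk] := hr _ _ Ga.
  have eqk l : r l a.2 < r l a.1 -> l = k.
    by move=> ltl; apply: contraTeq ltl => /negPf lk; have := hk l; rewrite lk => /lt_gtF->.
  by rewrite (eqk i) // (eqk j).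
have disF i j : F i != F j -> [disjoint F i & F j].
  apply: contraNT => /pred0Pn[a /andP[/= ai aj]].
  by rewrite (uniqF i j a).
exists [set F i | i : 'I_3].
  apply/andP; split; first by apply/forall_inP => _ /imsetP[i _ ->].
  by apply/trivIsetP => _ _ /imsetP[i _ ->] /imsetP[j _ ->]; apply: disF.
(* The dicycle [c] makes every [F i] nonempty, so that disjointness makes the three sets
   distinct. *)
rewrite card_imset ?card_ord // => i j Fij.
have /fasP[_ /(_ c dc)/set0Pn[a /setIP[ai _]]] := fasF i.
by apply: (uniqF i j a) => //; rewrite -Fij.
Qed.

Lemma digirth_ge3_asym : leq_inf 3 (digirth G) -> forall x y, G x y -> ~~ G y x.
Proof.
move=> g3 x y Gxy; apply/negP=> Gyx.
have dxy : dicycle G [:: x; y].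
  rewrite /dicycle /= inE Gxy Gyx andbT /= andbT.
  by apply: contraTneq Gxy => ->; rewrite arc_irr.
have := digirthP G; case: (digirth G) g3 => [n|_ /(_ [:: x; y])]; last by rewrite dxy.
by move=> /= n3 [_ /(_ _ dxy)] /(leq_trans n3).
Qed.

Lemma beta_acyclic : (forall c, ~~ dicycle G c) -> beta G = 0.
Proof.
move=> acG; apply/eqP; rewrite -leqn0 -(cards0 (V * V)%type); apply: beta_le.
by apply/fasP; split=> [|c dc]; [exact: sub0set | have := acG c; rewrite dc].
Qed.

End Digraph.

Local Close Scope ring_scope.

Theorem corollary3 (V : finType) (G : digraph V)
  (hG : partial_ktree 3 (underlying G)) :
  (leq_inf 3 (digirth G) ->
     ((beta G)%:R <= (num_arcs G)%:R / 3%:R :> rat)%R) /\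
  (digirth G = Some 3 -> Some (nu G) = digirth G).
Proof.
have pack3 c : leq_inf 3 (digirth G) -> dicycle G c ->
    exists2 P, packing G P & #|P| = 3.
  move=> /digirth_ge3_asym /(partial_3tree_realizes hG)[r hr].
  exact: backward_packing hr.
split=> [g3|g3].
  rewrite ler_pdivlMr // -natrM ler_nat mulnC.
  (* Infinite girth is treated apart: [pack3] asks for a dicycle, and without one [beta G] is 0. *)
  have := digirthP G; case: {-1}(digirth G) (erefl (digirth G)) => [n _|_].
    by case=> [[c dc _] _]; have [P /beta_packing + <-] := pack3 c g3 dc.
  by move=> /beta_acyclic->; rewrite muln0.
have := digirthP G; rewrite g3 => -[[c dc sc] _].
congr Some; apply/eqP; rewrite eqn_leq -{1}sc nu_le_dicycle //=.
have [P packP cP] : exists2 P, packing G P & #|P| = 3 by apply: pack3 dc; rewrite g3.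
by rewrite -cP; apply: leq_bigmax_cond.
Qed.
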